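(* Let $q\in\mathbb N$ be even and $\alpha>0$, and let $X\in\mathbb R^{n\times d}$ with rows $x_1,\dots,x_n$ satisfy $\|X\|_{2\to\bar q}\le\alpha$. Then \[ \Big\|\frac1n\sum_{i=1}^n x_i^{\otimes q/2}\,\big[x_i^{\otimes q/2}\big]^\top\Big\|_{\mathrm{op}} \le \alpha^q\, d^{q/4}. \] Further, when $q$ is divisible by $4$, there exist constants $K_q, C_q, c_q>0$ depending only on $q$ such that whenever $n \ge K_q d^{q/2}$ there exists a matrix $X\in\mathbb R^{n\times d}$ with rows $x_1,\dots,x_n$ such that $\|X\|_{2\to\bar q}\le C_q$ but \[ \Big\|\frac1n\sum_{i=1}^n x_i^{\otimes q/2}\,\big[x_i^{\otimes q/2}\big]^\top\Big\|_{\mathrm{op}} \ge c_q\, d^{q/4}. \]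
   Context: For $X\in\mathbb R^{n\times d}$ with rows $x_i$, $\|X\|_{2\to\bar q} = \sup_{v\in\mathbb R^d,\|v\|_2=1}\left(\frac1n\sum_{i=1}^n\langle x_i,v\rangle^q\right)^{1/q}$. Here $x_i^{\otimes q/2}\in\mathbb R^{d^{q/2}}$ is the flattened tensor power, so $\frac1n\sum_i x_i^{\otimes q/2}[x_i^{\otimes q/2}]^\top$ is a $d^{q/2}\times d^{q/2}$ matrix, and $\|\cdot\|_{\mathrm{op}}$ is the spectral norm. *)

(* Defs.v *)
From mathcomp Require Import all_boot all_order all_algebra.
From mathcomp Require Import mxtens.
From mathcomp Require Import all_classical all_reals all_analysis.

Set Implicit Arguments.
Unset Strict Implicit.
Unset Printing Implicit Defensive.

Import Order.TTheory GRing.Theory Num.Theory.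

Local Open Scope classical_set_scope.
Local Open Scope ring_scope.

Definition dotv (R : realType) (d : nat) (u v : 'cV[R]_d) : R :=
  \sum_(j < d) u j 0 * v j 0.

(* The norm notation of the library on matrices is the max norm, hence this
   Euclidean one. *)
Definition l2norm (R : realType) (d : nat) (v : 'cV[R]_d) : R :=
  Num.sqrt (\sum_(j < d) v j 0 ^+ 2).

Definition rowv (R : realType) (n d : nat) (X : 'M[R]_(n, d)) (i : 'I_n) :
    'cV[R]_d :=
  (row i X)^T.

(* The normalized norm ||X||_{2 -> \bar q}.  The set is bounded, and it is
   nonempty as soon as 0 < d; the real [sup] of the empty set is 0. *)
Definition norm2qbar (R : realType) (q n d : nat) (X : 'M[R]_(n, d)) : R :=
  sup [set (n%:R^-1 * \sum_(i < n) dotv (rowv X i) v ^+ q) `^ (q%:R^-1)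
       | v in [set v : 'cV[R]_d | l2norm v = 1]].

Definition opnorm (R : realType) (m p : nat) (A : 'M[R]_(m, p)) : R :=
  sup [set l2norm (A *m v) | v in [set v : 'cV[R]_p | l2norm v = 1]].

(* The flattened tensor power: the iterated Kronecker product [x ^t k] has
   type 'M_(d ^ k, 1 ^ k); the cast turns it into a column vector. *)
Definition tensv (R : realType) (d k : nat) (x : 'cV[R]_d) : 'cV[R]_(d ^ k) :=
  castmx (erefl (d ^ k)%N, exp1n k) (ntensmx x k).

Definition tensor_moment (R : realType) (k n d : nat) (X : 'M[R]_(n, d)) :
    'M[R]_(d ^ k) :=
  n%:R^-1 *: \sum_(i < n) tensv k (rowv X i) *m (tensv k (rowv X i))^T.

(* Main.v *)
Require Import Defs.
From mathcomp Require Import all_boot all_order all_algebra finfield.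
From mathcomp Require Import mxtens.
From mathcomp Require Import all_classical all_reals all_analysis.
From mathcomp Require Import ring lra.

(** Upper bound: the operator norm of [M = mean_i T_i T_i^T], with
    [T_i = x_i^(tensor k)] and [q = 2 k], is at most its Frobenius norm, and
    [|M|_F^2 = mean_(i,j) <x_i, x_j>^q <= alpha^q mean_j |x_j|^q
             <= alpha^(2 q) d^(q/2)],
    the last step by the power mean inequality and the moments of [X] in the
    coordinate directions.

    Lower bound: [M] dominates [w w^T] for [w = mean_i T_i], so its norm is at
    least [|w|^2 = mean_(i,j) <x_i, x_j>^(q/2)].  For [q = 4 m] and rows with
    entries [+1] or [-1] this is at least [(mean_(i,j) <x_i, x_j>^2)^m >= d^m].
    It remains to find [O(d^(q/2))] sign vectors that are [q]-wise independent:
    their [q]-th moments are then those of Rademacher sums, which are bounded by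
    Khintchine's inequality.  Dual BCH codes over a field of characteristic 2
    have this property. *)

Set Implicit Arguments.
Unset Strict Implicit.
Unset Printing Implicit Defensive.

Import Order.TTheory GRing.Theory Num.Theory.

Local Open Scope ring_scope.

(** * Cauchy-Schwarz, Chebyshev and power mean inequalities for finite sums *)

Section FiniteSums.
Variables (R : realFieldType) (I : finType).
Implicit Types a b : I -> R.

(** Lagrange's identity: the double sum of the squares of [a i * b j - a j * b i] is twice the
    difference of the two sides. *)
Lemma sum_sqr_cauchy_schwarz a b :
  (\sum_i a i * b i) ^+ 2 <= (\sum_i a i ^+ 2) * \sum_i b i ^+ 2.
Proof.
have : 0 <= \sum_i \sum_j (a i * b j - a j * b i) ^+ 2.
  by apply: sumr_ge0 => i _; apply: sumr_ge0 => j _; exact: sqr_ge0.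
have -> : \sum_i \sum_j (a i * b j - a j * b i) ^+ 2 =
    \sum_i \sum_j a i ^+ 2 * b j ^+ 2 + \sum_i \sum_j b i ^+ 2 * a j ^+ 2
    - 2 * \sum_i \sum_j (a i * b i) * (a j * b j).
  rewrite -big_split mulr_sumr -sumrB /=; apply: eq_bigr => i _.
  by rewrite -big_split mulr_sumr -sumrB /=; apply: eq_bigr => j _; ring.
by rewrite -!big_distrlr /=; nra.
Qed.

(** On nonnegative reals [a] and [a ^+ k] are ordered alike, so each product of their differences is
    nonnegative; expand the double sum. *)
Lemma chebyshev_sum a k : (forall i, 0 <= a i) ->
  (\sum_i a i) * (\sum_i a i ^+ k) <= #|I|%:R * \sum_i a i ^+ k.+1.
Proof.
move=> a0.
have : 0 <= \sum_i \sum_j (a i - a j) * (a i ^+ k - a j ^+ k).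
  apply: sumr_ge0 => i _; apply: sumr_ge0 => j _.
  case: (lerP (a i) (a j)) => h; last first.
    by rewrite mulr_ge0 // subr_ge0 ?lerXn2r ?nnegrE // ltW.
  by rewrite mulr_le0 // subr_le0 // lerXn2r ?nnegrE.
have -> : \sum_i \sum_j (a i - a j) * (a i ^+ k - a j ^+ k) =
    \sum_i \sum_(j : I) a i ^+ k.+1 + \sum_(i : I) \sum_j a j ^+ k.+1
    - (\sum_i \sum_j a i * a j ^+ k + \sum_i \sum_j a i ^+ k * a j).
  rewrite -!big_split -sumrB /=; apply: eq_bigr => i _.
  by rewrite -!big_split -sumrB /=; apply: eq_bigr => j _; rewrite !exprS; ring.
rewrite -!big_distrlr /= sumr_const.
under eq_bigr do rewrite sumr_const -mulr_natl.
rewrite -mulr_sumr -[X in _ + X - _]mulr_natl; lra.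
Qed.

Lemma power_mean a k : (forall i, 0 <= a i) ->
  (\sum_i a i) ^+ k.+1 <= #|I|%:R ^+ k * \sum_i a i ^+ k.+1.
Proof.
move=> a0; elim: k => [|k IHk].
  by rewrite expr0 mul1r expr1; under [leRHS]eq_bigr do rewrite expr1.
rewrite exprS; apply: le_trans (ler_wpM2l _ IHk) _; first exact: sumr_ge0.
by rewrite mulrCA exprSr -mulrA ler_wpM2l ?exprn_ge0 // chebyshev_sum.
Qed.

End FiniteSums.

(** * Euclidean, Frobenius and operator norms *)

Section Norms.
Variable R : realType.

(** The sign condition covers the empty set, whose [sup] is 0; it arises in dimension 0, where there
    are no unit vectors. *)
Lemma sup_le_ge0 (E : set R) c : 0 <= c -> (forall y, E y -> y <= c) ->
  sup E <= c.
Proof.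
move=> c0 Ec; have [[y Ey]|/set0P/negP] := pselect (E !=set0)%classic.
  by apply: ge_sup => //; exists y.
by rewrite negbK => /eqP ->; rewrite sup0.
Qed.

Lemma l2normK d (v : 'cV[R]_d) : l2norm v ^+ 2 = dotv v v.
Proof.
rewrite /l2norm sqr_sqrtr; first by apply: eq_bigr => j _; rewrite expr2.
by apply: sumr_ge0 => j _; exact: sqr_ge0.
Qed.

Lemma dotv_sqr d (v : 'cV[R]_d) : dotv v v = \sum_j v j 0 ^+ 2.
Proof. by apply: eq_bigr => j _; rewrite expr2. Qed.

Lemma dotvv_ge0 d (v : 'cV[R]_d) : 0 <= dotv v v.
Proof. by rewrite -l2normK sqr_ge0. Qed.

Lemma l2norm_ge0 d (v : 'cV[R]_d) : 0 <= l2norm v.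
Proof. exact: sqrtr_ge0. Qed.

Lemma dotvC d (u v : 'cV[R]_d) : dotv u v = dotv v u.
Proof. by apply: eq_bigr => j _; rewrite mulrC. Qed.

Lemma dotvZr d c (u v : 'cV[R]_d) : dotv u (c *: v) = c * dotv u v.
Proof.
by rewrite /dotv mulr_sumr; apply: eq_bigr => j _; rewrite mxE mulrCA.
Qed.

Lemma dotv_sumr d (I : finType) (u : 'cV[R]_d) (F : I -> 'cV[R]_d) :
  dotv u (\sum_i F i) = \sum_i dotv u (F i).
Proof.
rewrite /dotv exchange_big /=; apply: eq_bigr => j _.
by rewrite summxE mulr_sumr.
Qed.

Lemma cauchy_schwarz d (u v : 'cV[R]_d) :
  dotv u v ^+ 2 <= dotv u u * dotv v v.
Proof. by rewrite !dotv_sqr; exact: sum_sqr_cauchy_schwarz. Qed.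

Lemma dotv_le_l2norm d (u v : 'cV[R]_d) : dotv u v <= l2norm u * l2norm v.
Proof.
rewrite (le_trans (ler_norm _)) // -ler_sqr ?nnegrE ?mulr_ge0 ?l2norm_ge0 //.
by rewrite exprMn !l2normK real_normK ?num_real // cauchy_schwarz.
Qed.

Lemma dotv_mx d (u v : 'cV[R]_d) : u^T *m v = (dotv u v)%:M.
Proof.
apply/matrixP => i j; rewrite !mxE !ord1 eqxx mulr1n.
by apply: eq_bigr => l _; rewrite !mxE.
Qed.

Lemma l2norm_normalize d (v : 'cV[R]_d) :
  dotv v v != 0 -> l2norm ((l2norm v)^-1 *: v) = 1.
Proof.
move=> v0; have nv0 : l2norm v != 0 by rewrite -sqrf_eq0 l2normK.
apply/eqP; rewrite -(eqrXn2 (n := 2)) ?l2norm_ge0 // l2normK dotvZr dotvC.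
by rewrite dotvZr -l2normK expr1n; apply/eqP; field.
Qed.

Definition frob2 m p (A : 'M[R]_(m, p)) := \sum_i \sum_j A i j ^+ 2.

Lemma frob2_ge0 m p (A : 'M[R]_(m, p)) : 0 <= frob2 A.
Proof. by apply: sumr_ge0 => i _; apply: sumr_ge0 => j _; exact: sqr_ge0. Qed.

Lemma frob2_mulmxv m p (A : 'M[R]_(m, p)) v :
  l2norm (A *m v) <= Num.sqrt (frob2 A) * l2norm v.
Proof.
rewrite -ler_sqr ?nnegrE ?mulr_ge0 ?sqrtr_ge0 ?l2norm_ge0 //.
rewrite exprMn !l2normK sqr_sqrtr ?frob2_ge0 // !dotv_sqr mulr_suml.
by apply: ler_sum => i _; rewrite mxE; exact: sum_sqr_cauchy_schwarz.
Qed.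

Lemma opnorm_le_frob2 m p (A : 'M[R]_(m, p)) : opnorm A <= Num.sqrt (frob2 A).
Proof.
apply: sup_le_ge0; first exact: sqrtr_ge0.
by move=> _ [v /= v1 <-]; rewrite (le_trans (frob2_mulmxv _ _)) // v1 mulr1.
Qed.

Lemma le_opnorm m p (A : 'M[R]_(m, p)) v : l2norm v = 1 ->
  l2norm (A *m v) <= opnorm A.
Proof.
move=> v1; apply: ub_le_sup; last by exists v.
exists (Num.sqrt (frob2 A)) => _ [w /= w1 <-].
by rewrite (le_trans (frob2_mulmxv _ _)) // w1 mulr1.
Qed.

Lemma opnorm_ge0 m p (A : 'M[R]_(m, p)) : 0 <= opnorm A.
Proof.
have [[v v1]|no] := pselect (exists v : 'cV[R]_p, l2norm v = 1).
  exact: le_trans (l2norm_ge0 _) (le_opnorm A v1).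
by rewrite /opnorm sup_out // => -[[_ [v v1 _]] _]; apply: no; exists v.
Qed.

Lemma dotv_null d (u v : 'cV[R]_d) : dotv v v = 0 -> dotv u v = 0.
Proof.
move=> v0; apply/eqP; rewrite -sqrf_eq0 eq_le sqr_ge0 andbT.
by rewrite (le_trans (cauchy_schwarz u v)) // v0 mulr0.
Qed.

Lemma quadratic_le_opnorm d (A : 'M[R]_d) (w : 'cV[R]_d) :
  dotv w (A *m w) <= opnorm A * dotv w w.
Proof.
have [w0|w0] := eqVneq (dotv w w) 0.
  by rewrite w0 mulr0 dotvC dotv_null.
have nw0 : 0 < l2norm w.
  by rewrite lt_neqAle l2norm_ge0 andbT eq_sym -sqrf_eq0 l2normK.
set c := l2norm w in nw0.
have := le_opnorm A (l2norm_normalize w0); rewrite -/c => leA.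
have := le_trans (dotv_le_l2norm (c^-1 *: w) (A *m (c^-1 *: w)))
  (ler_wpM2l (l2norm_ge0 _) leA).
rewrite l2norm_normalize // mul1r -scalemxAr dotvZr dotvC dotvZr dotvC.
rewrite mulrA -expr2 exprVn mulrC ler_pdivrMr ?exprn_gt0 //.
by rewrite /c l2normK.
Qed.

(** * Inner products of tensor powers and Gram sums *)

(** Kronecker products multiply factor by factor, and each factor is the scalar [dotv x y]. The
    entrywise form is used because [1 ^ k] is not convertible to 1. *)
Lemma ntensmx_dotv d k (x y : 'cV[R]_d) i j :
  ((ntensmx x k)^T *m ntensmx y k) i j = dotv x y ^+ k.
Proof.
case: k i j => [|k] i j.
  by rewrite !ntensmx0 trmx1 mulmx1 !ord1 mxE.
elim: k i j => [|k IHk] i j.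
  by rewrite dotv_mx !ord1 mxE eqxx mulr1n expr1.
rewrite !ntensmxSS trmx_tens tensmx_mul.
case: (mxtens_indexP i) => i0 i1; case: (mxtens_indexP j) => j0 j1.
by rewrite tensmxE IHk dotv_mx !ord1 mxE eqxx mulr1n -exprS.
Qed.

Lemma dotv_castmx m n (e : n = 1%N) (A B : 'M[R]_(m, n)) i j :
  dotv (castmx (erefl m, e) A) (castmx (erefl m, e) B) = (A^T *m B) i j.
Proof.
subst n; rewrite !castmx_id !ord1 mxE.
by apply: eq_bigr => l _; rewrite mxE.
Qed.

Lemma dotv_tensv d k (x y : 'cV[R]_d) :
  dotv (tensv k x) (tensv k y) = dotv x y ^+ k.
Proof.
pose i := cast_ord (esym (exp1n k)) ord0.
by rewrite (dotv_castmx _ _ _ i i) ntensmx_dotv.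
Qed.

(** Both sides expand to the sum over [i], [j], [a], [b] of the products of the entries [a] and [b]
    of [T i] and of [T j]. *)
Lemma frob2_gram n d (T : 'I_n -> 'cV[R]_d) :
  frob2 (\sum_i T i *m (T i)^T) = \sum_i \sum_j dotv (T i) (T j) ^+ 2.
Proof.
rewrite /frob2 !pair_bigA /=.
under [LHS]eq_bigr => ab _.
  rewrite summxE expr2 big_distrlr pair_bigA /=.
  over.
rewrite exchange_big /=; apply: eq_bigr => -[i j] _ /=.
rewrite expr2 big_distrlr pair_bigA /=; apply: eq_bigr => -[a b] _ /=.
by rewrite !mxE !big_ord1 !mxE; ring.
Qed.

Lemma frob2Z m p c (A : 'M[R]_(m, p)) : frob2 (c *: A) = c ^+ 2 * frob2 A.
Proof.
rewrite /frob2 mulr_sumr; apply: eq_bigr => i _; rewrite mulr_sumr.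
by apply: eq_bigr => j _; rewrite mxE exprMn.
Qed.

Lemma frob2_tensor_moment k n d (X : 'M[R]_(n, d)) :
  frob2 (tensor_moment k X)
    = n%:R^-1 ^+ 2 * \sum_i \sum_j dotv (rowv X i) (rowv X j) ^+ k.*2.
Proof.
rewrite frob2Z frob2_gram; congr (_ * _).
apply: eq_bigr => i _; apply: eq_bigr => j _.
by rewrite dotv_tensv -exprM muln2.
Qed.

(** * Upper bound on the operator norm *)

Section Upper.
Variables (k n d : nat) (X : 'M[R]_(n, d)) (alpha : R).
Hypotheses (k_gt0 : (0 < k)%N) (alpha_gt0 : 0 < alpha).
Hypothesis leX : norm2qbar k.*2 X <= alpha.

Let mom (v : 'cV[R]_d) := n%:R^-1 * \sum_(i < n) dotv (rowv X i) v ^+ k.*2.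

Lemma even_moment_ge0 v : 0 <= mom v.
Proof.
rewrite mulr_ge0 ?invr_ge0 // sumr_ge0 // => i _.
by rewrite -mul2n exprM exprn_ge0 ?sqr_ge0.
Qed.

Lemma unit_moment_le v : l2norm v = 1 -> mom v <= alpha ^+ k.*2.
Proof.
move=> v1; have q0 : (k.*2)%:R != 0 :> R by rewrite pnatr_eq0 double_eq0 -lt0n.
have momK u : mom u = (mom u `^ (k.*2)%:R^-1) ^+ k.*2.
  by rewrite -powR_mulrn ?powR_ge0 // -powRrM mulVf // powRr1 ?even_moment_ge0.
rewrite momK lerXn2r ?nnegrE ?powR_ge0 ?(ltW alpha_gt0) //.
apply: le_trans leX; apply: ub_le_sup; last by exists v.
(* A [sup] dominates its members only if the set is bounded; by Cauchy-Schwarz every unit direction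
   has moment at most the mean of the [|x_i|^(2k)]. *)
exists ((n%:R^-1 * \sum_i dotv (rowv X i) (rowv X i) ^+ k) `^ (k.*2)%:R^-1).
move=> _ [u /= u1 <-]; apply: ge0_ler_powR.
- by rewrite invr_ge0.
- by rewrite nnegrE even_moment_ge0.
- rewrite nnegrE mulr_ge0 ?invr_ge0 // sumr_ge0 // => i _.
  by rewrite exprn_ge0 ?dotvv_ge0.
rewrite ler_wpM2l ?invr_ge0 //; apply: ler_sum => i _.
rewrite -mul2n exprM lerXn2r ?nnegrE ?sqr_ge0 ?dotvv_ge0 //.
rewrite (le_trans (cauchy_schwarz _ _)) // -[dotv u u]l2normK u1.
by rewrite expr1n mulr1.
Qed.

(** Homogeneity of degree [k.*2] reduces this to unit vectors; at the zero vector both sides vanish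
    because [k] is positive. *)
Lemma moment_le y : mom y <= alpha ^+ k.*2 * dotv y y ^+ k.
Proof.
have [y0|y0] := eqVneq (dotv y y) 0.
  rewrite y0 expr0n gtn_eqF // mulr0 /mom big1 ?mulr0 // => i _.
  by rewrite dotv_null // expr0n double_eq0 gtn_eqF.
have ny0 : 0 < l2norm y.
  by rewrite lt_neqAle l2norm_ge0 andbT eq_sym -sqrf_eq0 l2normK.
have := unit_moment_le (l2norm_normalize y0).
rewrite -[dotv y y]l2normK -exprM mul2n /mom.
under eq_bigr do rewrite dotvZr exprMn.
rewrite -mulr_sumr mulrCA exprVn mulrC ler_pdivrMr ?exprn_gt0 //.
Qed.

(** The power mean inequality over the coordinates gives [|x|^(2k) <= d^(k-1) sum_t x_t^(2k)]; each
    of the [d] coordinate directions then contributes at most [alpha ^+ k.*2]. *)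
Lemma mean_norm_le :
  n%:R^-1 * \sum_i dotv (rowv X i) (rowv X i) ^+ k <= alpha ^+ k.*2 * d%:R ^+ k.
Proof.
apply: (@le_trans _ _ (n%:R^-1 * \sum_i d%:R ^+ k.-1 * \sum_t X i t ^+ k.*2)).
  rewrite ler_wpM2l ?invr_ge0 //; apply: ler_sum => i _; rewrite dotv_sqr.
  have := @power_mean R _ (fun t => rowv X i t 0 ^+ 2) k.-1
    (fun t => sqr_ge0 _).
  rewrite card_ord prednK // => /le_trans; apply.
  rewrite ler_wpM2l ?exprn_ge0 //.
  by apply: ler_sum => t _; rewrite !mxE -exprM mul2n.
rewrite -mulr_sumr mulrCA exchange_big /=.
rewrite -[X in _ <= _ * _ ^+ X](prednK k_gt0) exprSr [leRHS]mulrCA.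
rewrite ler_wpM2l ?exprn_ge0 // mulr_sumr -[X in _ * X%:R](card_ord d).
rewrite mulr_natr -sumr_const; apply: ler_sum => t _.
have tt1 : dotv (delta_mx t 0) (delta_mx t 0) = 1 :> R.
  rewrite dotv_sqr (bigD1 t) //= mxE !eqxx expr1n big1 ?addr0 // => s st.
  by rewrite mxE (negbTE st) expr0n.
have := moment_le (delta_mx t 0).
rewrite tt1 expr1n mulr1; apply: le_trans; rewrite ler_wpM2l ?invr_ge0 //.
apply: ler_sum => i _; rewrite /dotv (bigD1 t) //= big1 ?addr0 => [|s st].
  by rewrite !mxE !eqxx /= mulr1.
by rewrite [X in _ * X]mxE (negbTE st) mulr0.
Qed.

Lemma opnorm_tensor_moment_le :
  opnorm (tensor_moment k X) <= alpha ^+ k.*2 * Num.sqrt (d%:R ^+ k).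
Proof.
apply: le_trans (opnorm_le_frob2 _) _.
have a0 : 0 <= alpha ^+ k.*2 by rewrite exprn_ge0 ?ltW.
rewrite -[X in X * _](ger0_norm a0) -sqrtr_sqr -sqrtrM ?sqr_ge0 //.
rewrite ler_wsqrtr // frob2_tensor_moment exchange_big /=.
rewrite expr2 -mulrA mulr_sumr.
(* After the exchange each inner mean is the moment in the direction of one row, to which
   [moment_le] applies. *)
apply: (@le_trans _ _
  (n%:R^-1 * \sum_i alpha ^+ k.*2 * dotv (rowv X i) (rowv X i) ^+ k)).
  by rewrite ler_wpM2l ?invr_ge0 //; apply: ler_sum => i _; exact: moment_le.
rewrite -mulr_sumr mulrCA expr2 -mulrA ler_wpM2l //.
exact: mean_norm_le.
Qed.

End Upper.

(** * Lower bound on the operator norm *)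

(** Test vector: the unnormalized sum [w] of the tensors [T i]. Its quadratic form is the mean of
    [dotv (T i) w ^+ 2], at least [|w|^4 / n^2] by Cauchy-Schwarz; divide by [|w|^2]. *)
Lemma mean_gram_le_opnorm k n d (X : 'M[R]_(n, d)) :
  n%:R^-1 ^+ 2 * \sum_i \sum_j dotv (rowv X i) (rowv X j) ^+ k
    <= opnorm (tensor_moment k X).
Proof.
pose T i := tensv k (rowv X i); pose w := \sum_i T i.
have ww : dotv w w = \sum_i \sum_j dotv (rowv X i) (rowv X j) ^+ k.
  rewrite {2}/w dotv_sumr; apply: eq_bigr => i _; rewrite dotvC dotv_sumr.
  by apply: eq_bigr => j _; rewrite dotv_tensv.
rewrite -ww; have [w0|w0] := eqVneq (dotv w w) 0.
  by rewrite w0 mulr0 opnorm_ge0.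
have ww_gt0 : 0 < dotv w w by rewrite lt_neqAle eq_sym w0 dotvv_ge0.
rewrite -(ler_pM2r ww_gt0); apply: le_trans (quadratic_le_opnorm _ _).
have -> : dotv w (tensor_moment k X *m w) = n%:R^-1 * \sum_i dotv (T i) w ^+ 2.
  have -> : tensor_moment k X *m w = n%:R^-1 *: \sum_i dotv (T i) w *: T i.
    rewrite -scalemxAl mulmx_suml; congr (_ *: _); apply: eq_bigr => i _.
    by rewrite -mulmxA dotv_mx mul_mx_scalar.
  rewrite dotvZr dotv_sumr; congr (_ * _); apply: eq_bigr => i _.
  by rewrite dotvZr [dotv w _]dotvC -expr2.
have [->|n0] := eqVneq (n%:R : R) 0; first by rewrite invr0 expr0n !mul0r.
have n_gt0 : 0 < n%:R :> R by rewrite lt0r n0 ler0n.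
rewrite expr2 -!mulrA ler_wpM2l ?invr_ge0 // ler_pdivrMl // -expr2.
have {1}-> : dotv w w = \sum_i dotv (T i) w * 1.
  by rewrite {2}/w dotv_sumr; apply: eq_bigr => i _; rewrite mulr1 dotvC.
apply: le_trans (sum_sqr_cauchy_schwarz _ _) _; rewrite mulrC.
by under eq_bigr do rewrite expr1n; rewrite sumr_const card_ord.
Qed.

(** The [d] diagonal entries of the sum of the [x_i x_i^T] all equal [n], so the squared inner
    products of the rows add up to at least [d n^2]. The power mean inequality over the [n^2] pairs
    raises this to the power [m.+1]. *)
Lemma opnorm_tensor_moment_signs m n d (X : 'M[R]_(n, d)) : (0 < n)%N ->
    (forall i t, X i t ^+ 2 = 1) ->
  d%:R ^+ m.+1 <= opnorm (tensor_moment m.+1.*2 X).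
Proof.
move=> n0 X1; apply: le_trans (mean_gram_le_opnorm _ _).
have n0R : 0 < n%:R :> R by rewrite ltr0n.
rewrite exprVn ler_pdivlMl ?exprn_gt0 //.
have gram2 : d%:R * n%:R ^+ 2
    <= \sum_i \sum_j dotv (rowv X i) (rowv X j) ^+ 2 :> R.
  rewrite -(frob2_gram (rowv X)) mulr_natl -[X in _ *+ X](card_ord d).
  rewrite -sumr_const; apply: ler_sum => t _; rewrite (bigD1 t) //= summxE.
  rewrite (eq_bigr (fun=> 1)) ?sumr_const ?card_ord ?lerDl.
    by apply: sumr_ge0 => s _; exact: sqr_ge0.
  by move=> i _; rewrite mxE big_ord1 !mxE -expr2 X1.
rewrite pair_bigA /= in gram2; rewrite pair_bigA /=.
have := @power_mean R _
  (fun p : 'I_n * 'I_n => dotv (rowv X p.1) (rowv X p.2) ^+ 2) m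
  (fun p => sqr_ge0 _).
rewrite card_prod !card_ord natrM -expr2.
under [X in _ <= _ * X -> _]eq_bigr do rewrite -exprM mul2n.
set G := \sum_p _ => pm.
rewrite -(ler_pM2l (exprn_gt0 m (exprn_gt0 2 n0R))); apply: le_trans pm.
rewrite mulrA -exprSr -exprMn [_ * d%:R]mulrC lerXn2r // nnegrE.
  by rewrite mulr_ge0 ?exprn_ge0.
by apply: sumr_ge0 => p _; exact: sqr_ge0.
Qed.

Lemma norm2qbar_le q n d (X : 'M[R]_(n, d)) B : 0 <= B ->
    (forall v, l2norm v = 1 ->
      0 <= n%:R^-1 * \sum_i dotv (rowv X i) v ^+ q <= B) ->
  norm2qbar q X <= B `^ q%:R^-1.
Proof.
move=> B0 XB; apply: sup_le_ge0; first exact: powR_ge0.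
move=> _ [v /= v1 <-]; have /andP[m0 mB] := XB v v1.
by apply: ge0_ler_powR; rewrite ?nnegrE // invr_ge0.
Qed.

End Norms.

(** * Repeating the points of a finite set to fill [n] rows *)

(** Run cyclically through [A]. The [n] indices fit into [l = n %/ #|A| + 1] full rounds, and
    [l * #|A| <= n + #|A| <= 2 * n]. *)
Lemma equidistributed_map (R : realFieldType) (A : finType) n :
    (0 < #|A|)%N -> (#|A| <= n)%N ->
  exists h : 'I_n -> A, forall G : A -> R, (forall a, 0 <= G a) ->
    #|A|%:R * \sum_i G (h i) <= 2 * n%:R * \sum_a G a.
Proof.
set N := #|A| => N0 leNn; pose g j : A := enum_val (Ordinal (ltn_pmod j N0)).
exists g => G G0; pose l := (n %/ N).+1.
have sum_g : \sum_(i < l * N) G (g i) = l%:R * \sum_a G a.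
  have -> : l%:R * \sum_a G a
      = (\sum_(i < l) 1) * \sum_(j < #|A|) G (enum_val j).
    by rewrite sumr_const card_ord -big_enum_val.
  rewrite mulr_sum; apply: eq_bigr => i _; rewrite mul1r.
  by congr (G (enum_val _)); apply: val_inj.
have lel : (n <= l * N)%N by rewrite ltnW // ltn_ceil.
apply: (@le_trans _ _ (N%:R * (l%:R * \sum_a G a))).
  rewrite ler_wpM2l // -sum_g -!(big_mkord xpredT (fun i => G (g i))).
  by rewrite [leRHS](big_cat_nat (n := n)) //= lerDl sumr_ge0.
rewrite mulrA ler_wpM2r ?sumr_ge0 // -natrM -natrM ler_nat.
by rewrite mul2n mulnC /l mulSn -addnn leq_add // leq_trunc_div.
Qed.

(** * Khintchine's inequality for even moments *)

Section Rademacher.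
Variables (R : realFieldType) (T : finType).
Local Notation signs := {ffun T -> bool}.
Implicit Types (v : T -> R) (e : signs).

(** The even total degree permits absolute values on the right; then replace both factors by the
    larger one. *)
Lemma exprM_le_addX (x y : R) i j :
  ~~ odd (i + j) -> x ^+ i * y ^+ j <= x ^+ (i + j) + y ^+ (i + j).
Proof.
move=> ev; have nn (z : R) : z ^+ (i + j) = `|z| ^+ (i + j).
  by rewrite -normrX ger0_norm // real_exprn_even_ge0 // num_real.
rewrite (nn x) (nn y); apply: le_trans (ler_norm _) _; rewrite normrM !normrX.
case: (lerP `|x| `|y|) => h.
  apply: le_trans (_ : `|y| ^+ (i + j) <= _).
    by rewrite exprD ler_wpM2r ?exprn_ge0 // lerXn2r ?nnegrE.
  by rewrite lerDr exprn_ge0.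
apply: le_trans (_ : `|x| ^+ (i + j) <= _).
  by rewrite exprD ler_wpM2l ?exprn_ge0 // lerXn2r ?nnegrE // ltW.
by rewrite lerDl exprn_ge0.
Qed.

Definition signed_sum v e := \sum_t v t * (-1) ^+ e t.

Definition flip (u : T) e : signs := [ffun t => e t (+) (t == u)].

Lemma flipK u : involutive (flip u).
Proof. by move=> e; apply/ffunP=> t; rewrite !ffunE -addbA addbb addbF. Qed.

Lemma sum_flip u (F : signs -> R) :
  \sum_(e : signs) F (flip u e) = \sum_(e : signs) F e.
Proof. by rewrite [RHS](reindex_inj (inv_inj (flipK u))). Qed.

Lemma signed_sum_flip v u e :
  signed_sum v (flip u e) = signed_sum v e - 2 * (v u * (-1) ^+ e u).
Proof.
rewrite /signed_sum (bigD1 u) //= [in RHS](bigD1 u) //=.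
rewrite ffunE eqxx addbT.
under eq_bigr => t /negbTE tu do rewrite ffunE tu addbF.
by case: (e u) => /=; rewrite ?expr0 ?expr1; ring.
Qed.

(* A discrete integration by parts: flipping the sign at [u] turns
   [(-1)^(e u) S^(2k+1)] into a difference quotient. *)
Lemma signed_sum_by_parts v u k :
  \sum_(e : signs) v u * (-1) ^+ e u * signed_sum v e ^+ k.*2.+1
    <= (2 * k.*2.+1%:R) * v u ^+ 2 * \sum_(e : signs) signed_sum v e ^+ k.*2.
Proof.
set S := signed_sum v.
pose G e := v u * (-1) ^+ e u * S e ^+ k.*2.+1.
have dbl : 2 * \sum_(e : signs) G e =
    \sum_(e : signs)
      v u * (-1) ^+ e u * (S e ^+ k.*2.+1 - S (flip u e) ^+ k.*2.+1).
  rewrite mulr_natl mulr2n -{2}(sum_flip u) -big_split /=.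
  apply: eq_bigr => e _; rewrite /G ffunE eqxx addbT.
  by case: (e u) => /=; rewrite ?expr0 ?expr1; ring.
have bnd e : v u * (-1) ^+ e u * (S e ^+ k.*2.+1 - S (flip u e) ^+ k.*2.+1)
    <= 2 * v u ^+ 2 * k.*2.+1%:R * (S e ^+ k.*2 + S (flip u e) ^+ k.*2).
  have SB : S e - S (flip u e) = 2 * (v u * (-1) ^+ e u).
    by rewrite /S signed_sum_flip opprB addrC subrK.
  rewrite subrXX SB.
  (* [Q] is the cofactor of the difference of powers: each of its [k.*2.+1] terms has even total
     degree [k.*2], hence is at most [W]. *)
  set Q := \sum_(_ < _) _; set W := _ + _.
  have leQ : Q <= k.*2.+1%:R * W.
    rewrite mulr_natl -[X in _ *+ X](card_ord k.*2.+1) -sumr_const.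
    apply: ler_sum => i _ /=; have lei : (i <= k.*2)%N by rewrite -ltnS.
    by have := @exprM_le_addX (S e) (S (flip u e)) (k.*2 - i) i;
      rewrite subnK // odd_double; apply.
  have -> : v u * (-1) ^+ e u * (2 * (v u * (-1) ^+ e u) * Q)
      = 2 * v u ^+ 2 * Q * ((-1) ^+ e u) ^+ 2 by ring.
  by rewrite sqrr_sign mulr1 -[leRHS]mulrA ler_wpM2l // mulr_ge0 ?sqr_ge0.
rewrite -(ler_pM2l (ltr0Sn R 1)) dbl.
rewrite (le_trans (ler_sum _ (fun e _ => bnd e))) //.
rewrite -mulr_sumr big_split /= (sum_flip u (fun e => S e ^+ k.*2)).
by rewrite le_eqVlt; apply/orP; left; apply/eqP; ring.
Qed.

(** Expand one factor of the power as the sum of its signed terms and integrate each by parts. *)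
Lemma signed_sum_momentS v k :
  \sum_(e : signs) signed_sum v e ^+ k.+1.*2
    <= (2 * k.*2.+1)%:R * (\sum_t v t ^+ 2)
       * \sum_(e : signs) signed_sum v e ^+ k.*2.
Proof.
rewrite mulr_sumr mulr_suml.
under eq_bigr => e _ do rewrite doubleS exprS {1}/signed_sum mulr_suml.
rewrite exchange_big /=; apply: ler_sum => u _.
by rewrite natrM; exact: signed_sum_by_parts.
Qed.

(** The constant is [2^k] times the double factorial [(2k-1)!!], one factor for each integration by
    parts. *)
Lemma signed_sum_moment v k :
  \sum_(e : signs) signed_sum v e ^+ k.*2
    <= (\prod_(j < k) (2 * j.*2.+1))%:R * (\sum_t v t ^+ 2) ^+ k
       * #|{: signs}|%:R.
Proof.
elim: k => [|k IHk].
  by rewrite big_ord0 expr0 !mul1r (eq_bigr (fun=> 1)) // sumr_const.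
apply: le_trans (signed_sum_momentS v k) _.
apply: le_trans (ler_wpM2l _ IHk) _.
  by rewrite mulr_ge0 // sumr_ge0 // => t _; rewrite sqr_ge0.
rewrite big_ord_recr /= exprS [in leRHS]natrM.
by rewrite le_eqVlt; apply/orP; left; apply/eqP; ring.
Qed.

End Rademacher.

(** * Moments of sign vectors with limited independence *)

Section EvenTuples.
Variables (R : realFieldType) (T : finType) (q : nat).
Implicit Types (v y : T -> R) (f : {ffun 'I_q -> T}).

Definition mult f (u : T) := #|[pred i | f i == u]|.

(** These are the tuples that survive in the expansion of a [q]-th moment: their monomial is 1 at
    every sign vector. *)
Definition even_tuple f := [forall u, ~~ odd (mult f u)].

Lemma prod_mult y f : \prod_i y (f i) = \prod_u y u ^+ mult f u.
Proof.
rewrite (partition_big f xpredT) //=; apply: eq_bigr => u _.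
by rewrite -prodr_const; apply: eq_bigr => i /eqP ->.
Qed.

Lemma prod_even_tuple y f :
  (forall u, y u ^+ 2 = 1) -> even_tuple f -> \prod_i y (f i) = 1.
Proof.
move=> y2 /forallP ev; rewrite prod_mult big1 // => u _.
by rewrite -(odd_double_half (mult f u)) (negbTE (ev u)) add0n -mul2n exprM y2
  expr1n.
Qed.

(** Expand the power over index tuples. The resulting mean over [A] no longer involves [x], so any
    two such designs have the same [q]-th moments. *)
Lemma moment_even_tuples (A : finType) (x : A -> T -> R) v :
    (forall a u, x a u ^+ 2 = 1) ->
    (forall f, ~~ even_tuple f -> \sum_a \prod_i x a (f i) = 0) ->
  \sum_a (\sum_t v t * x a t) ^+ q
    = #|A|%:R * \sum_(f | even_tuple f) \prod_i v (f i).
Proof.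
move=> x2 xodd.
have expand a : (\sum_t v t * x a t) ^+ q =
    \sum_(f : {ffun 'I_q -> T}) (\prod_i v (f i)) * \prod_i x a (f i).
  rewrite -{1}(card_ord q) -prodr_const bigA_distr_bigA.
  by apply: eq_bigr => f _; rewrite big_split.
under eq_bigr do rewrite expand.
rewrite exchange_big /= (bigID even_tuple) /= [X in _ + X]big1 ?addr0.
  rewrite mulr_sumr; apply: eq_bigr => f ev; rewrite -mulr_sumr mulrC.
  congr (_ * _); rewrite (eq_bigr (fun=> 1)) ?sumr_const // => a _.
  exact: prod_even_tuple.
by move=> f ev; rewrite -mulr_sumr xodd // mulr0.
Qed.

(** Flipping the sign at an index of odd multiplicity negates the sum. *)
Lemma sum_signs_odd_tuple f :
  ~~ even_tuple f ->
  \sum_(e : {ffun T -> bool}) \prod_i (-1) ^+ e (f i) = 0 :> R.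
Proof.
rewrite negb_forall => /existsP[u]; rewrite negbK => oddu.
have /eqP : \sum_(e : {ffun T -> bool}) \prod_i (-1) ^+ e (f i)
    = - \sum_(e : {ffun T -> bool}) \prod_i (-1) ^+ e (f i) :> R.
  rewrite -{1}(sum_flip u) -sumrN; apply: eq_bigr => e _.
  under eq_bigr do rewrite ffunE signr_addb.
  rewrite big_split /= [X in _ * X](bigID (fun i => f i == u)) /=.
  rewrite [X in _ * (_ * X)]big1.
    rewrite mulr1 [X in _ * X](eq_bigr (fun=> -1)) ?prodr_const.
      by rewrite -[#|_|]/(mult f u) -signr_odd oddu expr1 mulrN1.
    by move=> i /= ->.
  by move=> i /negbTE ->.
by rewrite -addr_eq0 -mulr2n mulrn_eq0 /= => /eqP.
Qed.

End EvenTuples.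

(** The full cube of signs is also such a design, so its Khintchine bound transfers to [x]. *)
Lemma even_tuple_moment (R : realFieldType) (T A : finType) (k : nat)
    (x : A -> T -> R) (v : T -> R) :
    (forall a u, x a u ^+ 2 = 1) ->
    (forall f : {ffun 'I_k.*2 -> T}, ~~ even_tuple f ->
       \sum_a \prod_i x a (f i) = 0) ->
  \sum_a (\sum_t v t * x a t) ^+ k.*2
    <= #|A|%:R * ((\prod_(j < k) (2 * j.*2.+1))%:R * (\sum_t v t ^+ 2) ^+ k).
Proof.
move=> x2 xodd; rewrite moment_even_tuples // ler_wpM2l //.
have card_gt0 : (0 : R) < #|{ffun T -> bool}|%:R.
  by rewrite ltr0n; apply/card_gt0P; exists [ffun=> true].
rewrite -(ler_pM2l card_gt0) [leRHS]mulrC.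
rewrite -(moment_even_tuples
  (x := fun (e : {ffun T -> bool}) t => (-1) ^+ e t)).
- exact: signed_sum_moment.
- by move=> e u; rewrite sqrr_sign.
- exact: sum_signs_odd_tuple.
Qed.

(** * Sign characters and dual BCH codes in characteristic 2 *)

Section BCH.
Variables (F : finFieldType).
Hypothesis charF : 2 \in [pchar F].

(** View [F] as a vector space over ['F_2] and take -1 to the power of a coordinate that does not
    vanish at 1. *)
Lemma nontrivial_sign_character (R : realFieldType) :
  exists psi : F -> R,
    [/\ forall x y, psi (x + y) = psi x * psi y, forall x, psi x ^+ 2 = 1
      & exists x, psi x = -1].
Proof.
pose V := pPrimeCharType charF.
pose c i := coord (vbasis (fullv : {vspace V})) i.
have [i ci] : exists i, c i (1 : V) != 0.
  apply/existsP; rewrite -negb_forall; apply/negP => /forallP z.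
  have := coord_vbasis (memvf (1 : V)); rewrite big1 => [/eqP|i _].
    by rewrite oner_eq0.
  by rewrite -/(c i) (eqP (z i)) scale0r.
pose phi (x : F) : 'F_2 := c i (x : V).
have phiD x y : phi (x + y) = phi x + phi y by rewrite /phi /c linearD.
exists (fun x => (-1) ^+ (phi x : nat)); split.
- move=> x y; rewrite phiD /= -exprD -[LHS]signr_odd -[RHS]signr_odd.
  by rewrite modn2 oddb.
- by move=> x; rewrite -exprM mulnC exprM sqrrN !expr1n.
- exists 1; move: ci; rewrite -/(phi 1).
  by case: (phi 1) => [[|[|]]].
Qed.

(** Translating [b] by [x / s], where [psi x = -1], negates the sum. *)
Lemma sum_sign_character (R : realFieldType) (psi : F -> R) (s : F) :
    (forall x y, psi (x + y) = psi x * psi y) -> (exists x, psi x = -1) ->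
  s != 0 -> \sum_b psi (b * s) = 0.
Proof.
move=> psiD [x px] s0.
have : \sum_b psi (b * s) = - \sum_b psi (b * s).
  rewrite {1}(reindex_inj (addIr (x / s))) -sumrN /=.
  by apply: eq_bigr => b _; rewrite mulrDl divfK // psiD px mulrN1.
by move/eqP; rewrite -addr_eq0 -mulr2n mulrn_eq0 /= => /eqP.
Qed.

(* In characteristic 2 the even power sums are squares of lower ones, so
   [P.[g (f i)]] sums to 0 for every [P] of degree below [2 k].  A polynomial
   that vanishes at all the values but one of odd multiplicity contradicts
   this. *)
Lemma odd_power_sums_even_tuple (T : finType) (g : T -> F) k
    (f : {ffun 'I_k.*2 -> T}) : injective g ->
  (forall j : 'I_k, \sum_i g (f i) ^+ j.*2.+1 = 0) -> even_tuple f.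
Proof.
move=> ginj podd.
have pall j : (j < k.*2)%N -> \sum_i g (f i) ^+ j = 0.
  elim/ltn_ind: j => j IHj ltj.
  have [->|j0] := posnP j.
    under eq_bigr do rewrite expr0.
    by rewrite sumr_const card_ord -mul2n mulrnA (pcharf0 charF) mul0rn.
  have [oj|ej] := boolP (odd j).
    have hj : (j./2 < k)%N.
      rewrite -ltn_double (leq_ltn_trans _ ltj) //.
      by rewrite -[leqRHS]odd_double_half leq_addl.
    have := podd (Ordinal hj).
    rewrite /= -[X in _ -> \sum_i _ ^+ X = _]odd_double_half.
    by rewrite oj add1n.
  have ej2 : j = (j./2 * 2)%N.
    by rewrite muln2 -{1}(odd_double_half j) (negbTE ej).
  have lt2 : (j./2 < j)%N.
    rewrite {2}ej2 muln2 -addnn -{1}(addn0 j./2) ltn_add2l half_gt0.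
    by case: (j) j0 ej => [|[]].
  rewrite ej2; under eq_bigr do rewrite exprM -(pFrobenius_autE charF).
  by rewrite -rmorph_sum IHj ?rmorph0 // (ltn_trans lt2).
have ppoly (P : {poly F}) : (size P <= k.*2)%N -> \sum_i P.[g (f i)] = 0.
  move=> szP.
  under eq_bigr do rewrite (horner_coef_wide _ szP).
  rewrite exchange_big /= big1 // => j _.
  by rewrite -mulr_sumr pall // mulr0.
apply/forallP => u; apply/negP => oddu.
have [i0 fi0] : exists i0, f i0 = u.
  have /card_gt0P[i] : (0 < mult f u)%N by case: (mult f u) oddu.
  by rewrite inE => /eqP; exists i.
pose s := enum [pred i | f i != u].
pose P := \prod_(i <- s) ('X - (g (f i))%:P).
(* The size is one more than the number of roots, and the index [i0] gives no root. *)
have szP : (size P <= k.*2)%N.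
  rewrite size_prod_XsubC -cardE -[ltnRHS](card_ord k.*2).
  by apply/proper_card/properP; split; [exact/subset_predT | exists i0];
    rewrite ?inE // fi0 eqxx.
have Pu : P.[g u] != 0.
  rewrite horner_prod prodf_seq_neq0; apply/allP => i.
  by rewrite mem_enum inE /= hornerXsubC subr_eq0 (inj_eq ginj) eq_sym.
have P0 i : f i != u -> P.[g (f i)] = 0.
  move=> fiu; rewrite horner_prod (bigD1_seq i) ?enum_uniq //=; last first.
    by rewrite mem_enum inE.
  by rewrite hornerXsubC subrr mul0r.
have /eqP := ppoly P szP; apply/negP.
rewrite (bigID (fun i => f i == u)) /= [X in _ + X]big1 ?addr0 //.
rewrite (eq_bigr (fun=> P.[g u])) => [|i /eqP -> //].
(* An odd number of copies of [P.[g u]] adds up to [P.[g u]] itself in characteristic 2. *)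
rewrite sumr_const -[#|_|]/(mult f u) -(odd_double_half (mult f u)) oddu.
by rewrite mulrnDr -mul2n mulrnA (mulrn_pchar charF) mul0rn addr0.
Qed.

End BCH.

(* The points are the words of a dual BCH code over a field of characteristic 2
   with between [d] and [2 d] elements, truncated to length [d]. *)
Lemma sign_design (R : realFieldType) (k d : nat) : (0 < d)%N ->
  exists (A : finType) (x : A -> 'I_d -> R),
    [/\ (0 < #|A|)%N, (#|A| <= (2 * d) ^ k)%N, forall a t, x a t ^+ 2 = 1
      & forall v : 'I_d -> R, \sum_a (\sum_t v t * x a t) ^+ k.*2
         <= #|A|%:R * ((\prod_(j < k) (2 * j.*2.+1))%:R
                       * (\sum_t v t ^+ 2) ^+ k)].
Proof.
move=> d0; have /andP[le_d lt_d] := trunc_log_bounds (isT : 1 < 2)%N d0.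
set m := trunc_log 2 d in le_d lt_d.
have [F charF cardF] := pPrimePowerField (isT : prime 2) (ltn0Sn m).
have [psi [psiD psi2 psiN]] := nontrivial_sign_character charF R.
have ledF : (d <= #|F|)%N by rewrite cardF ltnW.
pose g (t : 'I_d) : F := enum_val (widen_ord ledF t).
have ginj : injective g by move=> s t /enum_val_inj [] /val_inj.
have psi0 : psi 0 = 1.
  have [x px] := psiN; have /eqP := psiD x 0.
  by rewrite addr0 px mulN1r eqr_opp eq_sym => /eqP.
(* The word of [a] is [psi] applied to the values at the points [g t] of the odd polynomial with
   coefficients [a j] in degrees [j.*2.+1]. *)
exists {ffun 'I_k -> F}, (fun (a : {ffun 'I_k -> F}) t =>
  \prod_(j < k) psi (a j * g t ^+ j.*2.+1)).
have x2 (a : {ffun 'I_k -> F}) (t : 'I_d) :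
    (\prod_(j < k) psi (a j * g t ^+ j.*2.+1)) ^+ 2 = 1.
  by rewrite -prodrXl big1.
split => //.
- by rewrite card_ffun card_ord expn_gt0 (leq_trans d0).
- rewrite card_ffun card_ord cardF.
  have [->|k0] := posnP k; first by rewrite !expn0.
  by rewrite leq_exp2r // expnS leq_mul2l.
move=> v; apply: even_tuple_moment => // f.
(* If the sum over [a] is nonzero, every odd power sum must vanish, which makes [f] even. *)
apply: contraNeq => neq0; apply: (odd_power_sums_even_tuple charF ginj) => j.
apply/eqP; apply: contraNT neq0 => pj; apply/eqP.
under eq_bigr => a _.
  rewrite exchange_big /=.
  under eq_bigr => l _.
    rewrite -(big_morph psi psiD psi0) -mulr_sumr.
    over.
  over.
(* The sum over [a] factors into one character sum per coefficient, and the one for [j] is 0. *)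
rewrite -(bigA_distr_bigA
  (fun (l : 'I_k) b => psi (b * \sum_i g (f i) ^+ l.*2.+1))).
by rewrite (bigD1 j) //= (sum_sign_character psiD) // mul0r.
Qed.

Theorem theoremB1 (R : realType) (q : nat) (q_gt0 : (0 < q)%N)
    (q_even : ~~ odd q) :
  (forall (alpha : R) (n d : nat) (X : 'M[R]_(n, d)),
     0 < alpha -> norm2qbar q X <= alpha ->
     opnorm (tensor_moment q./2 X) <= alpha ^+ q * d%:R `^ (q%:R / 4%:R)) /\
  ((4 %| q)%N ->
   exists K C c : R, [/\ 0 < K, 0 < C, 0 < c &
     forall n d : nat, K * d%:R ^+ q./2 <= n%:R ->
       exists X : 'M[R]_(n, d),
         norm2qbar q X <= C /\
         c * d%:R `^ (q%:R / 4%:R) <= opnorm (tensor_moment q./2 X)]).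
Proof.
have qE : q = q./2.*2 by rewrite -{1}(odd_double_half q) (negbTE q_even).
set k := q./2 in qE *.
have k_gt0 : (0 < k)%N by rewrite -double_gt0 -qE.
split.
  move=> alpha n d X alpha0; rewrite qE => leX.
  rewrite (_ : k.*2%:R / 4%:R = k%:R * 2^-1); last first.
    by rewrite -mul2n natrM; field.
  rewrite powRrM powR_mulrn // powR12_sqrt ?exprn_ge0 //.
  exact: opnorm_tensor_moment_le.
case/dvdnP => m qm; have km : k = m.*2.
  by apply: double_inj; rewrite -qE qm -!muln2 -mulnA.
(* The factor 2 pays for the repetition of design points, the product is the Khintchine constant. *)
pose B : R := 2 * (\prod_(j < k) (2 * j.*2.+1))%:R.
have B_gt0 : 0 < B.
  by rewrite mulr_gt0 // ltr0n prodn_gt0 // => j; rewrite muln_gt0.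
(* The design has at most [(2 * d) ^ k] points, whence [K]; the bound for sign matrices allows
   [c = 1]. *)
exists (2 ^+ k), (B `^ q%:R^-1), 1; split; rewrite ?exprn_gt0 ?powR_gt0 //.
move=> n d; rewrite mul1r => le_n.
have -> : d%:R `^ (q%:R / 4) = d%:R ^+ m :> R.
  by rewrite qm natrM mulfK // powR_mulrn.
have m_gt0 : (0 < m)%N by rewrite -double_gt0 -km.
(* The design requires [0 < d]. For [d = 0] the norm is the [sup] of an empty set, and [d ^+ m] is 0
   because [m] is positive. *)
have [d0|d_gt0] := posnP d.
  subst d; exists 0; split; last first.
    rewrite expr0n -[_ == _]negbK -lt0n m_gt0.
    exact: opnorm_ge0.
  apply: sup_le_ge0; first exact: powR_ge0.
  move=> _ [v /= v1 <-]; move/eqP: v1.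
  by rewrite /l2norm big_ord0 sqrtr0 eq_sym oner_eq0.
have [A [x [A_gt0 leA x2 xmom]]] := sign_design R k d_gt0.
have leAn : (#|A| <= n)%N.
  by rewrite (leq_trans leA) // -(ler_nat R) natrX natrM exprMn.
have [h hG] := @equidistributed_map R A n A_gt0 leAn.
have n_gt0 : (0 < n)%N := leq_trans A_gt0 leAn.
pose X : 'M[R]_(n, d) := \matrix_(i, t) x (h i) t.
exists X; split; last first.
  rewrite km; case: (m) m_gt0 => // m' _.
  by apply: opnorm_tensor_moment_signs => // i t; rewrite mxE.
have even_ge0 (z : R) : 0 <= z ^+ q.
  by rewrite qE -mul2n exprM exprn_ge0 ?sqr_ge0.
apply: norm2qbar_le => [|v v1]; first exact: ltW.
apply/andP; split; first by rewrite mulr_ge0 ?invr_ge0 // sumr_ge0.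
pose G a := (\sum_t v t 0 * x a t) ^+ q.
have -> : \sum_i dotv (rowv X i) v ^+ q = \sum_i G (h i).
  apply: eq_bigr => i _; congr (_ ^+ _); apply: eq_bigr => t _.
  by rewrite !mxE mulrC.
have AR : 0 < #|A|%:R :> R by rewrite ltr0n.
rewrite ler_pdivrMl ?ltr0n // -(ler_pM2l AR).
apply: le_trans (hG G (fun a => even_ge0 _)) _.
have := xmom (fun t => v t 0).
rewrite -qE -dotv_sqr -l2normK v1 !expr1n mulr1 => le_mom.
apply: le_trans (ler_wpM2l _ le_mom) _; first by rewrite mulr_ge0.
by rewrite /B le_eqVlt; apply/orP; left; apply/eqP; ring.
Qed.
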